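(* Let $r^{c,D}, r^{c,E}\in\mathbb R$ be constants, let $P_0>0$ be a constant, and let $0\le \theta^0<\theta\le 1$. Let $(P_t)_{t\ge 0}$ be a non-negative continuous price process with initial value $P_0$ on a complete probability space $(\Omega,\mathcal F,\mathbb P)$, let $\mathbb F=(\mathcal F_t)_{t\ge 0}$ be the filtration generated by $P$ augmented by the $\mathbb P$-null sets, and let $\mathcal T$ be the set of $\mathbb F$-stopping times taking values in $[0,\infty)$. Assume that there are no market frictions and no spread between borrowing and lending rates (as described in the context), and let $\mathbb Q$ be a probability measure under which $\big(e^{-r^{c,D}t}P_t e^{r^{c,E}t}\big)_{t\ge 0}$ is an $\mathbb F$-martingale. Define $$\tau^B := \inf\left\{ t\in[0,\infty) \;\middle|\; \theta P_t e^{r^{c,E}t}\le \theta^0 P_0 e^{r^{c,D}t}\right\},\qquad \inf\emptyset=\infty .$$ Then it is optimal to exercise the loan contract at time $\tau^*=0$, i.e. the supremum below is attained at $\tau^*=0$, and consequently $$\sup_{\tau\in\mathcal T}\mathbb E^{\mathbb Q}\left[e^{-r^{c,D}\tau}\left(P_\tau e^{r^{c,E}\tau}-\theta^0P_0e^{r^{c,D}\tau}\right)\mathbf 1_{\{\tau<\tau^B\}}\right]=P_0(1-\theta^0).$$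
   Context: $P_t$ is the price at time $t$ of a risky asset (ETH) in units of a dollar stablecoin (USDC). The rates for borrowing and for providing collateral are $(r^{b,E},r^{c,E})$ for ETH and $(r^{b,D},r^{c,D})$ for USDC; the standing assumption here is no spread, $r^{b,D}=r^{c,D}$ and $r^{b,E}=r^{c,E}$, so only $r^{c,D}$ and $r^{c,E}$ appear. Loan contract: the borrower deposits 1 ETH as collateral (growing to value $P_te^{r^{c,E}t}$) and borrows $\theta^0P_0$ USDC (debt growing to $\theta^0P_0e^{r^{c,D}t}$), where $\theta^0$ is the initial loan-to-value. The initial capital (premium) needed is $P_0(1-\theta^0)$. The number $\theta\in(\theta^0,1]$ is the liquidation loan-to-value, and $\tau^B$ is the liquidation time, after which the position is worthless to the borrower. If the borrower pays back the loan (exercises) at a stopping time $\tau\in\mathcal T$, the payoff is $(P_\tau e^{r^{c,E}\tau}-\theta^0P_0e^{r^{c,D}\tau})\mathbf 1_{\{\tau<\tau^B\}}$. The non-arbitrage price of the contract is defined as the supremum over $\tau\in\mathcal T$ of the $\mathbb Q$-expected payoff discounted at rate $r^{c,D}$. Frictionless market assumption (modelling background): there is an external market where the agent can borrow and lend any amount of USDC at the riskless rate $r^{c,D}$ and can buy and sell any amount of the risky asset at price $P$, with no transaction costs and no price impact. Its mathematical role is to justify the definition of the price as $\sup_{\tau\in\mathcal T}\mathbb E^{\mathbb Q}\left[e^{-r^{c,D}\tau}\left(P_\tau e^{r^{c,E}\tau}-\theta^0P_0e^{r^{c,D}\tau}\right)\mathbf 1_{\{\tau<\tau^B\}}\right]$.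 *)

(* Defs.v *)
From HB Require Import structures.
From mathcomp Require Import all_boot all_order all_algebra.
From mathcomp Require Import all_classical all_reals all_analysis.

Set Implicit Arguments.
Unset Strict Implicit.
Unset Printing Implicit Defensive.

Import Order.TTheory GRing.Theory Num.Theory.
Import numFieldNormedType.Exports.

Local Open Scope classical_set_scope.
Local Open Scope ring_scope.

(* Time is a real number [t] restricted to [0 <= t]; values of processes at
   negative times are never used. *)
Section stochastic_processes.
Context (d : measure_display) (Omega : measurableType d) (R : realType).
Implicit Types (G : set (set Omega)) (F : R -> set (set Omega))
  (X : R -> Omega -> R) (Y Z : Omega -> R) (tau : Omega -> R).

Definition measurable_wrt G Y : Prop :=
  forall B : set R, measurable B -> G (Y @^-1` B).

Definition augmented_filtration (Pr : probability Omega R) X (t : R) :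
    set (set Omega) :=
  <<s (\bigcup_(s in `[0, t]) preimage_set_system setT (X s) measurable)
      `|` Pr.-negligible >>.

(* Finite stopping times, i.e. with values in [0, +oo[. *)
Definition stopping_time F tau : Prop :=
  (forall w, 0 <= tau w) /\
  (forall t : R, 0 <= t -> F t [set w | tau w <= t]).

(* [Z] is a version of the conditional expectation of [Y] given [G]. *)
Definition is_cond_expectation (Q : probability Omega R) G Y Z : Prop :=
  [/\ measurable_wrt G Z,
      Q.-integrable setT (EFin \o Z) &
      forall A, G A ->
        (\int[Q]_(w in A) (Z w)%:E = \int[Q]_(w in A) (Y w)%:E)%E].

Definition martingale (Q : probability Omega R) F X : Prop :=
  [/\ forall t : R, 0 <= t -> measurable_wrt (F t) (X t),
      forall t : R, 0 <= t -> Q.-integrable setT (EFin \o X t) &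
      forall s t : R, 0 <= s -> s <= t ->
        is_cond_expectation Q (F s) (X t) (X s)].

End stochastic_processes.

Section loan_contract.
Context (d : measure_display) (Omega : measurableType d) (R : realType).
(* [rD], [rE]: common borrowing/collateral rates of USDC and ETH;
   [theta0], [theta]: initial and liquidation loan-to-values;
   [P0]: initial price; [P]: price process. *)
Variables (rD rE theta0 theta P0 : R) (P : R -> Omega -> R).
Implicit Types (F : R -> set (set Omega)) (tau : Omega -> R).

Definition collateral_value (t : R) (w : Omega) : R := P t w * expR (rE * t).

Definition debt_value (t : R) : R := theta0 * P0 * expR (rD * t).

(* [ereal_inf set0 = +oo]: no liquidation. *)
Definition liquidation_time (w : Omega) : \bar R :=
  ereal_inf [set t%:E | t in
    [set t : R | 0 <= t /\ theta * collateral_value t w <= debt_value t]].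

Definition discounted_collateral (t : R) (w : Omega) : R :=
  expR (- rD * t) * collateral_value t w.

Definition discounted_payoff tau (w : Omega) : R :=
  expR (- rD * tau w)
  * (collateral_value (tau w) w - debt_value (tau w))
  * \1_[set v | ((tau v)%:E < liquidation_time v)%E] w.

Definition loan_price (Q : probability Omega R) F : \bar R :=
  ereal_sup [set 'E_Q[discounted_payoff tau]%E | tau in
    [set tau | stopping_time F tau]].

Definition optimal_exercise (Q : probability Omega R) F tau : Prop :=
  stopping_time F tau /\ 'E_Q[discounted_payoff tau]%E = loan_price Q F.

End loan_contract.

(* Main.v *)
(* Write S for the discounted collateral value, a non-negative continuous
   martingale with S 0 = P0, and K = theta0 * P0; liquidation happens when
   theta * S <= K. The discounted payoff of tau is S tau - K if tau precedes
   liquidation and 0 otherwise. For each n, stop S at the first time k / (n + 1)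
   that is >= tau or at which theta * S <= K. By discrete optional stopping these
   stopped values have expectation P0. Their lower limit is at least S tau if tau
   precedes liquidation, and at least K in any case, because S > K / theta >= K
   at the grid point before the stopping point and S is uniformly continuous. So
   it dominates payoff + K, and Fatou's lemma bounds the expected payoff of tau
   by P0 - K, which is the constant payoff of tau = 0. *)
Require Import Defs.
From mathcomp Require Import all_boot all_order all_algebra.
From mathcomp Require Import all_classical all_reals all_analysis.
From mathcomp Require Import measurable_realfun lra.

Import Order.TTheory GRing.Theory Num.Theory.
Import numFieldNormedType.Exports.

Local Open Scope classical_set_scope.
Local Open Scope ring_scope.

Set Implicit Arguments.
Unset Strict Implicit.

(** * Discrete optional stopping *)

Section stopped_sequence.
Context {T : Type} {V : Type}.
Variables (s : nat -> T -> V) (D : nat -> set T).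

(** [D i] is read as the event that nothing stops the walk at index [i], so on [alive k] the walk
    moves on past [k]. *)
Definition alive (k : nat) : set T := [set w | forall i, (i <= k)%N -> D i w].

(** This is [s] frozen at the first index outside [D]; the recursion avoids a random index, which
    [stoppedP] recovers pointwise. *)
Fixpoint stopped (k : nat) (w : T) : V :=
  if k is j.+1 then if w \in alive j then s k w else stopped j w else s 0 w.

Lemma aliveS k : alive k.+1 `<=` alive k.
Proof. by move=> w Dw i ik; apply: Dw; rewrite ltnW. Qed.

Lemma stopped_alive k w : alive k w -> stopped k w = s k w.
Proof.
by case: k => [//|k] /aliveS ak /=; rewrite mem_set.
Qed.

Lemma stoppedP k w : exists j, [/\ (j <= k)%N, stopped k w = s j w,
  (forall i, (i < j)%N -> D i w) & j = k \/ ~ D j w].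
Proof.
elim: k => [|k [j [jk sj Dj jD]]]; first by exists 0%N; split => //; left.
rewrite /=; case: ifPn => [|/negP]; rewrite inE => ak.
  by exists k.+1; split => //; left.
exists j; split => //; first by rewrite leqW.
right; case: jD => [jk_eq|//]; rewrite jk_eq in Dj * => Dk; apply: ak => i.
by rewrite leq_eqVlt => /predU1P[->|/Dj].
Qed.

End stopped_sequence.

Section stopped_integral.
Context d (T : measurableType d) (R : realType).
Variables (mu : {measure set T -> \bar R}) (s : nat -> T -> R).
Variable D : nat -> set T.
Hypothesis ms : forall k, measurable_fun setT (s k).
Hypothesis s_ge0 : forall k w, 0 <= s k w.
Hypothesis mD : forall k, measurable (alive D k).

Lemma measurable_stopped k : measurable_fun setT (stopped s D k).
Proof.
elim: k => [|k IH] //=; apply: measurable_fun_ifT => //.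
apply: (measurable_fun_bool true).
rewrite setTI [X in measurable X](_ : _ = alive D k)//.
by apply/seteqP; split => w; [exact: set_mem|exact: mem_set].
Qed.

Lemma stopped_ge0 k w : 0 <= stopped s D k w.
Proof. by have [j [_ -> _ _]] := stoppedP s D k w. Qed.

(** From [k] to [k.+1] the stopped value changes only on [alive D k], where [s k] becomes [s k.+1]
    with the same integral. Non-negativity allows splitting the integral along this event. *)
Lemma integral_stopped k :
  (forall j, (j < k)%N -> \int[mu]_(w in alive D j) (s j.+1 w)%:E =
     \int[mu]_(w in alive D j) (s j w)%:E)%E ->
  (\int[mu]_w (stopped s D k w)%:E = \int[mu]_w (s 0%N w)%:E)%E.
Proof.
elim: k => [//|k IH sE]; rewrite -IH; last first.
  by move=> j jk; apply: sE; exact: ltnW.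
have split_alive (f : T -> R) : measurable_fun setT f -> (forall w, 0 <= f w) ->
    (\int[mu]_w (f w)%:E = \int[mu]_(w in alive D k) (f w)%:E
      + \int[mu]_(w in ~` alive D k) (f w)%:E)%E.
  move=> mf f0; rewrite -ge0_integral_setU ?setUv//.
  - exact: measurableC.
  - exact/measurable_EFinP.
  - by move=> w _; rewrite lee_fin.
  - exact/disj_setPCl.
rewrite !split_alive; [|exact: measurable_stopped|move=> w; exact: stopped_ge0
  |exact: measurable_stopped k.+1|move=> w; exact: stopped_ge0 k.+1 w].
congr (_ + _)%E.
- rewrite [RHS](@eq_integral _ _ _ _ _ (fun w => (s k w)%:E)).
    rewrite -sE//; apply: eq_integral => w ak /=.
    by rewrite ak.
  by move=> w; rewrite inE => ak; rewrite stopped_alive.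
- apply: eq_integral => w; rewrite inE /= => ak.
  by rewrite memNset.
Qed.

End stopped_integral.

(** * A Fatou bound by simple functions *)

Section integral_nnsfun.
Import HBNNSimple.

(** The integral is a supremum over simple functions. This handles the payoff, with its random time
    and its infimum over uncountably many times, without proving it measurable. *)
Lemma ge0_integral_le_nnsfun d (T : measurableType d) (R : realType)
    (mu : {measure set T -> \bar R}) (f : T -> \bar R) (c : \bar R) :
  (forall w, 0 <= f w)%E ->
  (forall h : T -> R, measurable_fun setT h -> (forall w, 0 <= h w) ->
    (forall w, (h w)%:E <= f w)%E -> (\int[mu]_w (h w)%:E <= c)%E) ->
  (\int[mu]_w f w <= c)%E.
Proof.
move=> f0 hc; rewrite ge0_integralTE//; apply: ge_ereal_sup => _ [h /= hf <-].
rewrite -integralT_nnsfun; exact: hc.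
Qed.

End integral_nnsfun.

Lemma EFin_le_limn_einf (R : realType) (u : nat -> R) (c : R) :
  (forall e, 0 < e -> \forall n \near \oo, c - e <= u n) ->
  (c%:E <= limn_einf (EFin \o u))%E.
Proof.
move=> cu; rewrite limn_einf_lim; apply/lee_subgt0Pr => e e0.
apply: lime_ge; first exact: is_cvg_einfs.
have [N _ Nu] := cu e e0; exists N => // n /= Nn.
apply: le_ereal_inf_tmp => _ [m /= nm <-] /=.
by rewrite -EFinB lee_fin Nu//=; exact: leq_trans nm.
Qed.

(* [f] is not assumed measurable: its integral is a supremum over the simple
   functions below [f], and Fatou's lemma is applied to each of these. *)
Lemma integral_le_fatou d (T : measurableType d) (R : realType)
    (mu : probability T R) (f : T -> R) (M : nat -> T -> R) (c k : R) :
  0 <= k ->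
  (forall w, 0 <= f w) ->
  (forall n, measurable_fun setT (M n)) ->
  (forall n w, 0 <= M n w) ->
  (forall n, \int[mu]_w (M n w)%:E = c%:E)%E ->
  (forall w e, 0 < e -> \forall n \near \oo, f w + k - e <= M n w) ->
  (\int[mu]_w (f w)%:E <= (c - k)%:E)%E.
Proof.
move=> k0 f0 mM M0 MI fM; apply: ge0_integral_le_nnsfun => [w|h mh h0 hf].
  by rewrite lee_fin.
rewrite EFinB leeBrDr//.
(* Total mass 1 lets [k] enter the integrand, so that [h + k] can be compared with the lower limit
   of [M]. *)
have -> : k%:E = (\int[mu]_w (cst k%:E w))%E.
  by rewrite integral_cst// [X in (_ * X)%E]probability_setT mule1.
rewrite -ge0_integralD//; last 2 first.
- by move=> w _; rewrite lee_fin.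
- exact/measurable_EFinP.
have mMe n : measurable_fun setT (fun w => (M n w)%:E).
  exact/measurable_EFinP.
have M0e n w : setT w -> (0 <= (M n w)%:E)%E by rewrite lee_fin.
apply: le_trans (le_trans (fatou mu measurableT mMe M0e) _); last first.
  under eq_fun do rewrite MI.
  rewrite limn_einf_lim; apply: lime_le; first exact: is_cvg_einfs.
  apply: nearW => n; apply: ereal_inf_lbound; exists n => //=.
apply: ge0_le_integral => //.
- by move=> w _; rewrite -EFinD lee_fin addr_ge0.
- by apply: emeasurable_funD => //; exact/measurable_EFinP.
(* By definition the lower limit is minus the upper limit of the negated sequence. *)
- rewrite (_ : (fun w => _) = (fun w => - limn_esup (fun n => - (M n w)%:E))%E).
    apply: measurableT_comp => //.
    by apply: measurable_fun_limn_esup => n; exact: measurableT_comp.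
  by [].
- move=> w _; have := hf w; rewrite !lee_fin => hw.
  rewrite -EFinD; apply: EFin_le_limn_einf => e e0.
  apply: filterS (fM w e e0) => n; apply: le_trans.
  by rewrite lerD2r lerD2r.
Qed.

(** * Uniform continuity and walks along a time grid *)

Lemma within_unif_continuous (R : realType) (f : R -> R) (a b : R) :
  {within `[a, b], continuous f} ->
  forall e, 0 < e -> exists2 r : R, 0 < r &
    forall x y, x \in `[a, b] -> y \in `[a, b] -> `|x - y| < r ->
      `|f x - f y| < e.
Proof.
move=> fc' e e0; have fc := (subspace_continuousP _ _).1 fc'.
have /compact_near_coveringP/near_covering_withinP cov :=
  @segment_compact R a b.
(* [P r x] says that radius [r] works at [x]. Near each point all small radii work, and compactness
   gives one radius for the whole segment. *)
pose P (r x : R) :=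
  forall y, y \in `[a, b] -> `|x - y| < r -> `|f x - f y| < e.
have [|r /= r0 rP] := cov R 0^'+ P.
- move=> x xab; have e2 : 0 < e / 2 by rewrite divr_gt0.
  have /cvgrPdist_lt/(_ _ e2) := fc _ xab.
  rewrite near_withinE => -[r /= r0 fr].
  exists ([set z | `|x - z| < r / 2], [set u : R | u < r / 2]) => /=.
    split; first by exists (r / 2) => //=; rewrite divr_gt0.
    by apply: nbhs_right_lt; rewrite divr_gt0.
  move=> [z u] /= [xz ur] zab y yab zy.
  have xy : `|x - y| < r.
    rewrite (splitr r) -(subrK z x) -addrA (le_lt_trans (ler_normD _ _))//.
    by rewrite ltrD// (lt_trans zy).
  rewrite -(subrK (f x) (f z)) -addrA (le_lt_trans (ler_normD _ _))//.
  rewrite (splitr e) ltrD//; first rewrite distrC.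
    by apply: fr => //=; rewrite (lt_trans xz)// ltr_pdivrMr// ltr_pMr// ltr1n.
  by apply: fr.
exists (r / 2); first by rewrite divr_gt0.
move=> x y xab yab xy; apply: (rP (r / 2)) => //=.
  rewrite sub0r normrN gtr0_norm ?divr_gt0//.
  by rewrite ltr_pdivrMr// ltr_pMr// ltr1n.
by rewrite divr_gt0.
Qed.

(** Index [(n+1)^2] is time [n+1]: refining the mesh also sends the horizon to infinity. *)
Definition grid (R : realType) (n k : nat) : R := k%:R / n.+1%:R.

Lemma grid_ge0 (R : realType) n k : 0 <= grid R n k.
Proof. by rewrite divr_ge0. Qed.

Lemma gridS (R : realType) n k : grid R n k.+1 = grid R n k + n.+1%:R^-1.
Proof. by rewrite /grid -natr1 mulrDl div1r. Qed.

Lemma grid_le (R : realType) n j k : (j <= k)%N -> grid R n j <= grid R n k.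
Proof. by move=> jk; rewrite ler_pM2r ?invr_gt0// ler_nat. Qed.

(* [j] is the index at which the walk along the grid is stopped: either the last
   index, which lies beyond [tau] for large [n], or the first one that is past
   [tau] or liquidated. *)
Lemma grid_stopped_lb (R : realType) (f : R -> R) (tau theta K e : R) :
  {within `[0, +oo[, continuous f} -> 0 <= tau -> 0 <= K -> 0 < theta <= 1 ->
  K <= f 0 -> 0 < e ->
  \forall n \near \oo, forall j, (j <= n.+1 * n.+1)%N ->
    (forall i, (i < j)%N -> grid R n i < tau /\ K < theta * f (grid R n i)) ->
    (j = n.+1 * n.+1)%N \/ ~ (grid R n j < tau /\ K < theta * f (grid R n j)) ->
    K - e <= f (grid R n j) /\
    ((forall t, 0 <= t <= tau -> K < theta * f t) ->
      f tau - e <= f (grid R n j)).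
Proof.
move=> fc tau0 K0 /andP[th0 th1] Kf0 e0.
(* This compact interval contains [tau] and the stopping point, which is at most one mesh, hence at
   most 1, beyond [tau]. *)
have fc1 : {within `[0, tau + 1], continuous f}.
  by apply: continuous_subspaceW fc => t /=; rewrite !in_itv/= => /andP[->].
have [r r0 fr] := within_unif_continuous fc1 e0.
near=> n => j jN Dj jD.
have hr : (n.+1%:R : R)^-1 < r.
  rewrite invf_plt ?posrE//.
  apply: (@lt_trans _ _ n%:R); last by rewrite ltr_nat.
  by near: n; exact: nbhs_infty_gtr.
have ntau : tau < n%:R by near: n; exact: nbhs_infty_gtr.
have h0 : 0 < (n.+1%:R : R)^-1 by rewrite invr_gt0.
have h1 : (n.+1%:R : R)^-1 <= 1 by rewrite invf_le1// ler1n.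
have gj : grid R n j \in `[0, tau + 1].
  rewrite in_itv/= grid_ge0/=; case: j Dj {jN jD} => [|i] Dj.
    by rewrite /grid mul0r addr_ge0.
  by rewrite gridS lerD// ltW//; have [] := Dj i (ltnSn i).
split.
  case: j Dj gj {jN jD} => [|i] Dj gj.
    by rewrite /grid mul0r lerBlDr (le_trans Kf0)// lerDl ltW.
  have [gi Kgi] := Dj i (ltnSn i).
  have Kfi : K <= f (grid R n i).
    have fi0 : 0 < f (grid R n i).
      by rewrite -(pmulr_rgt0 _ th0) (le_lt_trans K0).
    by rewrite (le_trans (ltW Kgi))// ler_piMl// ltW.
  have gi' : grid R n i \in `[0, tau + 1].
    by rewrite in_itv/= grid_ge0/= (le_trans (ltW gi))// lerDl.
  have := fr _ _ gi' gj.
  rewrite gridS opprD addNKr normrN gtr0_norm// => /(_ hr).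
  by rewrite -gridS => /ltr_distlDr; lra.
(* Without liquidation up to [tau], the walk stops only by reaching [tau] or at the horizon
   [n+1 > tau]. Either way it stops at or after [tau], by at most one mesh. *)
move=> noliq; have tauj : tau <= grid R n j.
  rewrite leNgt; apply/negP => gjtau; case: jD => [jE|[]]; last first.
    by split => //; apply: noliq; rewrite grid_ge0 ltW.
  move: gjtau; rewrite jE /grid natrM mulfK//.
  by apply/negP; rewrite -leNgt (le_trans (ltW ntau))// ler_nat.
have jtau : grid R n j <= tau + n.+1%:R^-1.
  case: j Dj {jN jD gj tauj} => [|i] Dj.
    by rewrite /grid mul0r addr_ge0// ltW.
  by rewrite gridS lerD2r ltW//; have [] := Dj i (ltnSn i).
have tau_itv : tau \in `[0, tau + 1]. by rewrite in_itv/= tau0 lerDl ler01.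
have : `|tau - grid R n j| < r.
  by rewrite distrC ger0_norm ?subr_ge0// (le_lt_trans _ hr)// lerBlDl.
move=> /(fr _ _ tau_itv gj); rewrite ltr_distl => /andP[].
by move=> *; lra.
Unshelve. all: by end_near. Qed.

(** * The augmented filtration *)

Section augmented_filtration_theory.
Context d (Omega : measurableType d) (R : realType).
Variables (Pr : probability Omega R) (X : R -> Omega -> R).
Let F := augmented_filtration Pr X.

Lemma augmented_filtration_le (s t : R) : s <= t -> F s `<=` F t.
Proof.
move=> st; apply: sub_sigma_algebra2; apply: setSU.
apply: bigcup_sub => u /=; rewrite in_itv/= => /andP[u0 us].
apply: (@bigcup_sup _ _ u `[0, t]) => /=.
by rewrite in_itv/= u0 (le_trans us).
Qed.

(** Completeness of [Pr] makes the added null sets measurable. *)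
Lemma augmented_filtration_measurable (t : R) :
  measure_is_complete Pr ->
  (forall s, 0 <= s -> measurable_fun setT (X s)) -> F t `<=` measurable.
Proof.
move=> cPr mX; apply: smallest_sub; first exact: sigma_algebra_measurable.
move=> A [[s /= sI [B mB <-]]|/cPr//].
by apply: mX => //; move: sI; rewrite in_itv/= => /andP[].
Qed.

Lemma augmented_filtrationC (t : R) A : F t A -> F t (~` A).
Proof. by rewrite -setTD; exact: sigma_algebraCD. Qed.

Lemma augmented_filtration_alive (t : nat -> R) (D : nat -> set Omega) k :
  {homo t : i j / (i <= j)%N >-> i <= j} ->
  (forall i, F (t i) (D i)) -> F (t k) (alive D k).
Proof.
(* The finite intersection becomes the complement of a countable union, padded with empty sets
   beyond [k]. *)
move=> t_le FD; pose E i := if (i <= k)%N then ~` D i else set0.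
rewrite (_ : alive D k = ~` \bigcup_i E i).
  apply: augmented_filtrationC; apply: sigma_algebra_bigcup => i; rewrite /E.
  case: ifPn => [ik|_]; last exact: sigma_algebra0.
  apply: augmented_filtration_le (t_le _ _ ik) _ _.
  exact: augmented_filtrationC.
rewrite setC_bigcup; apply/seteqP; split => w Dw i.
  move=> _; rewrite /E /setC /=.
  by case: ifPn => [ik|_] /=; [apply; exact: Dw|].
by move=> ik; have := Dw i I; rewrite /E ik setCK.
Qed.

End augmented_filtration_theory.

(** * The loan contract: liquidation, payoff and the upper bound *)

Section loan.
Context d (Omega : measurableType d) (R : realType).
Variables (rD rE theta0 theta P0 : R) (P : R -> Omega -> R).
Hypotheses (P0_gt0 : 0 < P0) (theta0_ge0 : 0 <= theta0)
  (theta0_lt : theta0 < theta) (theta_le1 : theta <= 1)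
  (P_init : forall w, P 0 w = P0)
  (P_ge0 : forall t w, 0 <= t -> 0 <= P t w)
  (P_continuous : forall w,
      {within `[0, +oo[, continuous (fun t : R => P t w)}).

Local Notation S := (discounted_collateral rD rE P).
Local Notation K := (theta0 * P0).
Local Notation liquidation := (liquidation_time rD rE theta0 theta P0 P).
Local Notation payoff := (discounted_payoff rD rE theta0 theta P0 P).

Lemma discounted_collateral0 w : S 0 w = P0.
Proof.
by rewrite /discounted_collateral /collateral_value !mulr0 expR0 mul1r mulr1.
Qed.

Lemma discounted_collateral_ge0 t w : 0 <= t -> 0 <= S t w.
Proof. by move=> t0; rewrite !mulr_ge0 ?expR_ge0 ?P_ge0. Qed.

Lemma discounted_collateral_continuous w :
  {within `[0, +oo[, continuous (S ^~ w)}.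
Proof.
have cexp (c : R) : {within `[0, +oo[, continuous (fun t : R => expR (c * t))}.
  apply: continuous_subspaceT => t; apply: continuous_comp.
    exact: mulrl_continuous.
  exact: continuous_expR.
move=> t; apply: cvgM; first exact: cexp.
apply: cvgM; [exact: P_continuous|exact: cexp].
Qed.

Lemma liquidation_ltv t w :
  (theta * collateral_value rE P t w <= debt_value rD theta0 P0 t) =
  (theta * S t w <= K).
Proof.
rewrite /debt_value -ler_pdivrMr ?expR_gt0// -expRN -mulNr.
by rewrite -mulrA (mulrC (collateral_value _ _ _ _)).
Qed.

Lemma lt_liquidation_time tau w : (tau%:E < liquidation w)%E ->
  forall t, 0 <= t <= tau -> K < theta * S t w.
Proof.
move=> taul t /andP[t0 tt]; rewrite ltNge; apply/negP => Kt.
move: taul; apply/negP; rewrite -leNgt.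
apply: (@le_trans _ _ t%:E); last by rewrite lee_fin.
by apply: ereal_inf_lbound; exists t => //=; rewrite liquidation_ltv.
Qed.

Lemma discounted_payoffE tau w : payoff tau w =
  if ((tau w)%:E < liquidation w)%E then S (tau w) w - K else 0.
Proof.
rewrite /discounted_payoff indicE; case: ifPn => taul; last first.
  by rewrite memNset ?mulr0//; exact/negP.
rewrite mem_set//.
rewrite mulr1 mulrBr /debt_value (mulrCA (expR _) K) -expRD mulNr addNr.
by rewrite expR0 mulr1 -mulNr.
Qed.

(** At time 0, [S] equals [P0 > K / theta], as [theta0 < theta]; by continuity it stays above
    [K / theta] on some [[0, r)]. Hence exercise at 0 precedes liquidation. *)
Lemma liquidation_time_gt0 w : (0 < liquidation w)%E.
Proof.
have := (subspace_continuousP _ _).1 (@discounted_collateral_continuous w) 0.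
rewrite /= in_itv/= lexx => /(_ isT) /cvgrPdist_lt.
have th0 : 0 < theta by exact: le_lt_trans theta0_lt.
have e0 : 0 < P0 - K / theta.
  by rewrite subr_gt0 ltr_pdivrMr// mulrC ltr_pM2l.
move=> /(_ _ e0); rewrite near_withinE => -[r /= r0 Sr].
apply: (@lt_le_trans _ _ r%:E); first by rewrite lte_fin.
apply: le_ereal_inf_tmp => _ [t /= [t0 Kt] <-]; rewrite liquidation_ltv in Kt.
rewrite lee_fin leNgt; apply/negP => tr.
have /= := Sr t; rewrite sub0r normrN ger0_norm// in_itv/= t0 => /(_ tr isT).
move=> S0t; have : `|S 0 w - S t w| < P0 - K / theta := S0t.
rewrite discounted_collateral0 => /ltr_distlBl.
rewrite opprB addrC subrK.
by apply/negP; rewrite -leNgt ler_pdivlMr// mulrC.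
Qed.

Lemma discounted_payoff0 w : payoff (cst 0) w = P0 * (1 - theta0).
Proof.
rewrite discounted_payoffE liquidation_time_gt0 discounted_collateral0.
by rewrite mulrBr mulr1 mulrC.
Qed.

(** Before liquidation [K < theta * S <= S], since [theta <= 1]. *)
Lemma discounted_payoff_ge0 tau w : 0 <= tau w -> 0 <= payoff tau w.
Proof.
move=> tau0; rewrite discounted_payoffE; case: ifPn => // taul.
have := lt_liquidation_time taul; move=> /(_ (tau w)); rewrite tau0 lexx.
move=> /(_ isT) /ltW KS; rewrite subr_ge0 (le_trans KS)//.
by rewrite ler_piMl// discounted_collateral_ge0.
Qed.

Lemma expectation_payoff_le (Pr Q : probability Omega R)
    (Pr_complete : measure_is_complete Pr)
    (P_measurable : forall t, 0 <= t -> measurable_fun setT (P t))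
    (Q_martingale : martingale Q (augmented_filtration Pr P) S)
    (tau : Omega -> R) : stopping_time (augmented_filtration Pr P) tau ->
  ('E_Q[payoff tau] <= (P0 * (1 - theta0))%:E)%E.
Proof.
move=> [tau0 Ftau]; have [FS iS ES] := Q_martingale.
have th0 : 0 < theta by exact: le_lt_trans theta0_lt.
pose D n i := [set w | grid R n i < tau w /\ K < theta * S (grid R n i) w].
have FD n i : augmented_filtration Pr P (grid R n i) (D n i).
  (* The walk stops if [tau] is reached ([j = 0]) or on liquidation (repeated for every other [j]),
     again as a countable union. *)
  rewrite (_ : D n i = ~` (\bigcup_j (if j is 0%N then
    [set w | tau w <= grid R n i]
    else [set w | theta * S (grid R n i) w <= K]))).
    apply: augmented_filtrationC; apply: sigma_algebra_bigcup => -[|_].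
      by apply: Ftau; exact: grid_ge0.
    rewrite (_ : [set _ | _] = S (grid R n i) @^-1` `]-oo, K / theta]).
      by apply: FS; [exact: grid_ge0|exact: measurable_itv].
    by apply/seteqP; split=> w /=; rewrite in_itv/= ler_pdivlMr// mulrC.
  apply/seteqP; split => w /=.
    by move=> [tw Kw] [[|j] _ /=]; rewrite leNgt ?tw ?Kw.
  move=> Dw; split; rewrite ltNge; apply/negP => ?; apply: Dw.
    by exists 0%N.
  by exists 1%N.
have Falive n k : augmented_filtration Pr P (grid R n k) (alive (D n) k).
  by apply: (augmented_filtration_alive _ (FD n)) => i j; exact: grid_le.
have malive n k : measurable (alive (D n) k).
  exact: augmented_filtration_measurable (Falive n k).
have mS n k : measurable_fun setT (S (grid R n k)).
  by apply/measurable_EFinP/(measurable_int Q)/iS/grid_ge0.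
pose M n := stopped (fun k => S (grid R n k)) (D n) (n.+1 * n.+1).
rewrite unlock (_ : P0 * (1 - theta0) = P0 - K); last first.
  by rewrite mulrBr mulr1 mulrC.
apply: (integral_le_fatou (M := M)).
- by rewrite mulr_ge0// ltW.
- by move=> w; exact: discounted_payoff_ge0.
- by move=> n; exact: measurable_stopped.
- move=> n w; apply: stopped_ge0 => k {}w.
  exact/discounted_collateral_ge0/grid_ge0.
- move=> n; rewrite integral_stopped//.
  + rewrite (eq_integral (cst P0%:E)); last first.
      by move=> w _; rewrite /grid mul0r discounted_collateral0.
    by rewrite integral_cst// [X in (_ * X)%E]probability_setT mule1.
  + by move=> k w; exact/discounted_collateral_ge0/grid_ge0.
  + move=> j _.
    (* The event [alive (D n) j] belongs to the filtration at grid time [j], so the conditional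
       expectation identity applies on it. *)
    by have [_ _ <-//] := ES _ _ (grid_ge0 R n j) (grid_le R n (leqnSn j)).
- move=> w e e0.
  have := @grid_stopped_lb R (S ^~ w) (tau w) theta K e.
  move=> /(_ (@discounted_collateral_continuous w) (tau0 w)); case => //.
  + by rewrite mulr_ge0// ltW.
  + by rewrite th0.
  + rewrite discounted_collateral0 ler_piMl// ?ltW//.
    exact: lt_le_trans theta_le1.
  move=> N _ HN; exists N => // n /HN{}HN.
  rewrite /M; have [j [jN -> Dj jD]] :=
    stoppedP (fun k => S (grid R n k)) (D n) (n.+1 * n.+1) w.
  have [lbK lbS] := HN j jN Dj jD.
  (* Payoff plus [K] is [S tau] before liquidation and [K] otherwise, which matches the two bounds
     [lbS] and [lbK]. *)
  rewrite discounted_payoffE; case: ifPn => [taul|_]; last by rewrite add0r.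
  by rewrite subrK; apply: lbS; exact: lt_liquidation_time.
Qed.

End loan.

Theorem theorem3p1 (R : realType) (d : measure_display)
    (Omega : measurableType d) (Pr Q : probability Omega R)
    (rD rE theta0 theta P0 : R) (P : R -> Omega -> R)
    (Pr_complete : measure_is_complete Pr)
    (P0_gt0 : 0 < P0)
    (theta0_ge0 : 0 <= theta0)
    (theta0_lt : theta0 < theta)
    (theta_le1 : theta <= 1)
    (P_measurable : forall t : R, 0 <= t -> measurable_fun setT (P t))
    (P_init : forall w : Omega, P 0 w = P0)
    (P_ge0 : forall (t : R) (w : Omega), 0 <= t -> 0 <= P t w)
    (P_continuous : forall w : Omega,
      {within `[0, +oo[, continuous (fun t : R => P t w)})
    (Q_martingale : martingale Q (augmented_filtration Pr P)
      (discounted_collateral rD rE P)) :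
  optimal_exercise rD rE theta0 theta P0 P Q (augmented_filtration Pr P)
    (cst 0) /\
  loan_price rD rE theta0 theta P0 P Q (augmented_filtration Pr P) =
    (P0 * (1 - theta0))%:E.
Proof.
have st0 : stopping_time (augmented_filtration Pr P) (cst 0 : Omega -> R).
  split=> // t t0; rewrite (_ : [set _ | _] = ~` set0).
    by apply: augmented_filtrationC; exact: sigma_algebra0.
  by rewrite setC0; apply/seteqP; split.
have E0 : 'E_Q[discounted_payoff rD rE theta0 theta P0 P (cst 0)%R]%E =
    (P0 * (1 - theta0))%:E.
  rewrite -(expectation_cst Q); congr ('E_Q[_])%E; apply/funext => w.
  exact: discounted_payoff0.
have price : loan_price rD rE theta0 theta P0 P Q (augmented_filtration Pr P) =
    (P0 * (1 - theta0))%:E.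
  apply/eqP; rewrite eq_le; apply/andP; split.
    apply: ge_ereal_sup => _ [tau tauF <-].
    by apply: expectation_payoff_le P_measurable Q_martingale _ tauF.
  by rewrite -E0; apply: ereal_sup_ubound; exists (cst 0).
by split=> //; split=> //; rewrite price.
Qed.
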